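(* Let $\mathbf{A}$ be an additive category, let $\mathcal{O}$ be a class of objects of $\mathbf{A}$ containing $0$ and closed under isomorphism, and let $w$ be a weight on $\mathcal{O}$. Then for all $A,B\in\mathcal{O}$, $d_w(A,B)\le w(A)+w(B)$.
   Context: A weight on $\mathcal{O}$ is an assignment of $w(A)\in[0,\infty]$ to each $A\in\mathcal{O}$ such that $w(0)=0$ and $w(A)=w(B)$ whenever $A\cong B$. Path metric $d_w$: let $\mathcal{M}$ be the class of morphisms $f$ in $\mathbf{A}$ whose kernel and cokernel both exist and are in $\mathcal{O}$, and put $w(f)=w(\ker f)+w(\operatorname{coker}f)$ for $f\in\mathcal{M}$. A zigzag from $A$ to $B$ is a finite sequence of morphisms joining $A=A_0,A_1,\dots,A_n=B$ ($n\ge0$), the $i$-th one being a morphism between $A_{i-1}$ and $A_i$ in either direction. The cost of a zigzag all of whose morphisms are in $\mathcal{M}$ is the sum of the weights of its morphisms (and $0$ if $n=0$). $d_w(A,B)\in[0,\infty]$ is the infimum of the costs of all zigzags from $A$ to $B$ whose morphisms all lie in $\mathcal{M}$ ($\infty$ if there are none). *)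

(* Defs.v *)
From HB Require Import structures.
From mathcomp Require Import all_boot all_order all_algebra.
From mathcomp Require Import all_classical all_reals ereal.

Set Implicit Arguments.
Unset Strict Implicit.
Unset Printing Implicit Defensive.

Import Order.TTheory GRing.Theory Num.Theory.

Local Open Scope classical_set_scope.
Local Open Scope ring_scope.

Record preadditiveCategory := PreadditiveCategory {
  obj :> Type;
  Mor : obj -> obj -> zmodType;
  idm : forall A : obj, Mor A A;
  mcomp : forall A B C : obj, Mor B C -> Mor A B -> Mor A C;
  mcompA : forall (A B C D : obj) (h : Mor C D) (g : Mor B C) (f : Mor A B),
    mcomp h (mcomp g f) = mcomp (mcomp h g) f;
  mcomp1m : forall (A B : obj) (f : Mor A B), mcomp (idm B) f = f;
  mcompm1 : forall (A B : obj) (f : Mor A B), mcomp f (idm A) = f;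
  mcompDl : forall (A B C : obj) (g g' : Mor B C) (f : Mor A B),
    mcomp (g + g') f = mcomp g f + mcomp g' f;
  mcompDr : forall (A B C : obj) (g : Mor B C) (f f' : Mor A B),
    mcomp g (f + f') = mcomp g f + mcomp g f'
}.

Arguments Mor {p} A B : rename.
Arguments idm {p} A : rename.
Arguments mcomp {p A B C} g f : rename.

Notation "g \oc f" := (mcomp g f) (at level 40, left associativity).

Definition isZeroObject (C : preadditiveCategory) (Z : C) : Prop :=
  forall X : C, (exists! f : Mor Z X, True) /\ (exists! f : Mor X Z, True).

Definition isBiproduct (C : preadditiveCategory) (A B P : C)
    (i1 : Mor A P) (i2 : Mor B P) (p1 : Mor P A) (p2 : Mor P B) : Prop :=
  [/\ p1 \oc i1 = idm A, p2 \oc i2 = idm B, p1 \oc i2 = 0, p2 \oc i1 = 0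
    & i1 \oc p1 + i2 \oc p2 = idm P].

Record additiveCategory := AdditiveCategory {
  preadd :> preadditiveCategory;
  zeroObj : preadd;
  zeroObjP : isZeroObject zeroObj;
  has_biproducts : forall A B : preadd,
    exists (P : preadd) (i1 : Mor A P) (i2 : Mor B P)
           (p1 : Mor P A) (p2 : Mor P B), isBiproduct i1 i2 p1 p2
}.

Definition isomorphic (C : preadditiveCategory) (A B : C) : Prop :=
  exists (f : Mor A B) (g : Mor B A), g \oc f = idm A /\ f \oc g = idm B.

Definition isKernel (C : preadditiveCategory) (A B K : C)
    (f : Mor A B) (k : Mor K A) : Prop :=
  f \oc k = 0 /\
  forall (X : C) (g : Mor X A), f \oc g = 0 ->
    exists! h : Mor X K, k \oc h = g.

Definition isCokernel (C : preadditiveCategory) (A B Q : C)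
    (f : Mor A B) (q : Mor B Q) : Prop :=
  q \oc f = 0 /\
  forall (X : C) (g : Mor B X), g \oc f = 0 ->
    exists! h : Mor Q X, h \oc q = g.

Definition closedUnderIso (C : preadditiveCategory) (O : set C) : Prop :=
  forall A B : C, isomorphic A B -> O A -> O B.

(* A weight is defined on O only; it is encoded as a total function whose
   values outside O are unconstrained. *)
Definition isWeight (R : realType) (C : additiveCategory) (O : set C)
    (w : C -> \bar R) : Prop :=
  [/\ forall A, O A -> (0 <= w A)%E,
      w (zeroObj C) = 0%E
    & forall A B, O A -> O B -> isomorphic A B -> w A = w B].

Section PathMetric.
Context {R : realType} {C : additiveCategory}.

(* The kernel and cokernel objects, chosen arbitrarily among the isomorphic
   candidates; the value is the zero object when there is none. *)
Definition kerObj (A B : C) (f : Mor A B) : C :=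
  if pselect (exists (K : C) (k : Mor K A), isKernel f k) is left h
  then sval (cid h) else zeroObj C.

Definition cokerObj (A B : C) (f : Mor A B) : C :=
  if pselect (exists (Q : C) (q : Mor B Q), isCokernel f q) is left h
  then sval (cid h) else zeroObj C.

Definition classM (O : set C) (A B : C) (f : Mor A B) : Prop :=
  (exists (K : C) (k : Mor K A), isKernel f k /\ O K) /\
  (exists (Q : C) (q : Mor B Q), isCokernel f q /\ O Q).

Definition morWeight (w : C -> \bar R) (A B : C) (f : Mor A B) : \bar R :=
  (w (kerObj f) + w (cokerObj f))%E.

Inductive zigzag : C -> C -> Type :=
| zznil (A : C) : zigzag A A
| zzfwd (A A' B : C) (f : Mor A A') (z : zigzag A' B) : zigzag A B
| zzbwd (A A' B : C) (f : Mor A' A) (z : zigzag A' B) : zigzag A B.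

Fixpoint zigzagIn (O : set C) (A B : C) (z : zigzag A B) : Prop :=
  match z with
  | zznil _ => True
  | zzfwd _ _ _ f z' => classM O f /\ zigzagIn O z'
  | zzbwd _ _ _ f z' => classM O f /\ zigzagIn O z'
  end.

Fixpoint zigzagCost (w : C -> \bar R) (A B : C) (z : zigzag A B) : \bar R :=
  match z with
  | zznil _ => 0%E
  | zzfwd _ _ _ f z' => (morWeight w f + zigzagCost w z')%E
  | zzbwd _ _ _ f z' => (morWeight w f + zigzagCost w z')%E
  end.

Definition pathMetric (O : set C) (w : C -> \bar R) (A B : C) : \bar R :=
  ereal_inf [set zigzagCost w z | z in [set z : zigzag A B | zigzagIn O z]].

End PathMetric.

(* Main.v *)
(** The zigzag [A -> 0 <- B] has cost [w(A) + w(B)]: the zero morphism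
    [A -> 0] has kernel [A] and cokernel [0]. *)

Require Import Defs.
From HB Require Import structures.
From mathcomp Require Import all_boot all_order all_algebra.
From mathcomp Require Import all_classical all_reals ereal.

Set Implicit Arguments.
Unset Strict Implicit.
Unset Printing Implicit Defensive.

Import GRing.Theory.

Local Open Scope ring_scope.

Section Preadditive.
Context {C : preadditiveCategory}.

(** A zero morphism [A -> B] has kernel [idm A] and cokernel [idm B], so it lies in the class M as
    soon as [A] and [B] are in [O]. Its weight is computed from arbitrarily chosen kernel and
    cokernel objects; since these are unique up to isomorphism and [w] is isomorphism-invariant on
    [O], the weight is [w A + w B] ([morWeight_zero]). With [w] zero at the zero object, the legs of
    [A -> 0 <- B] cost [w A] and [w B]. *)

Lemma mcomp0m (X Y Z : C) (f : Mor X Y) : (0 : Mor Y Z) \oc f = 0.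
Proof. by apply: (addrI (0 \oc f)); rewrite -mcompDl !addr0. Qed.

Lemma mcompm0 (X Y Z : C) (g : Mor Y Z) : g \oc (0 : Mor X Y) = 0.
Proof. by apply: (addrI (g \oc 0)); rewrite -mcompDr !addr0. Qed.

Lemma isKernel_zero (A B : C) : isKernel (0 : Mor A B) (idm A).
Proof.
split=> [|X g _]; first by rewrite mcomp0m.
by exists g; split=> [|h]; rewrite mcomp1m.
Qed.

Lemma isCokernel_zero (A B : C) : isCokernel (0 : Mor A B) (idm B).
Proof.
split=> [|X g _]; first by rewrite mcompm0.
by exists g; split=> [|h]; rewrite mcompm1.
Qed.

Lemma isKernel_isomorphic (A B K L : C) (f : Mor A B)
    (k : Mor K A) (l : Mor L A) :
  isKernel f k -> isKernel f l -> isomorphic K L.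
Proof.
move=> [fk0 kU] [fl0 lU].
have [u [lu _]] := lU _ _ fk0; have [v [kv _]] := kU _ _ fl0.
exists u, v; split.
(* Both [idm K] and [v \oc u] solve [k \oc h = k], whose solution is unique. *)
- have [h [_ hU]] := kU _ _ fk0.
  by rewrite -(hU (idm K)) ?mcompm1//; symmetry; apply: hU; rewrite mcompA kv.
- have [h [_ hU]] := lU _ _ fl0.
  by rewrite -(hU (idm L)) ?mcompm1//; symmetry; apply: hU; rewrite mcompA lu.
Qed.

Lemma isCokernel_isomorphic (A B P Q : C) (f : Mor A B)
    (p : Mor B P) (q : Mor B Q) :
  isCokernel f p -> isCokernel f q -> isomorphic P Q.
Proof.
move=> [pf0 pU] [qf0 qU].
have [u [up _]] := pU _ _ qf0; have [v [vq _]] := qU _ _ pf0.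
exists u, v; split.
- have [h [_ hU]] := pU _ _ pf0.
  by rewrite -(hU (idm P)) ?mcomp1m//; symmetry; apply: hU; rewrite -mcompA up.
- have [h [_ hU]] := qU _ _ qf0.
  by rewrite -(hU (idm Q)) ?mcomp1m//; symmetry; apply: hU; rewrite -mcompA vq.
Qed.

End Preadditive.

Section Weight.
Context {R : realType} {C : additiveCategory}.
Variables (O : set C) (w : C -> \bar R).
Hypotheses (O_iso : closedUnderIso O) (w_weight : isWeight O w).

(** Makes the weight independent of the choice hidden in [kerObj]: the chosen kernel is isomorphic
    to [K], hence also in [O], where [w] is invariant. *)
Lemma weight_kerObj (A B K : C) (f : Mor A B) (k : Mor K A) :
  isKernel f k -> O K -> w (kerObj f) = w K.
Proof.
case: w_weight => _ _ wiso kP OK; rewrite /kerObj.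
(* The default value of [kerObj] does not arise, because [k] is a kernel. *)
case: pselect => [h|[]]; last by exists K, k.
case: (cid h) => L [l lP] /=.
have KL := isKernel_isomorphic kP lP.
by symmetry; apply: wiso => //; exact: O_iso KL OK.
Qed.

Lemma weight_cokerObj (A B Q : C) (f : Mor A B) (q : Mor B Q) :
  isCokernel f q -> O Q -> w (cokerObj f) = w Q.
Proof.
case: w_weight => _ _ wiso qP OQ; rewrite /cokerObj.
case: pselect => [h|[]]; last by exists Q, q.
case: (cid h) => L [l lP] /=.
have QL := isCokernel_isomorphic qP lP.
by symmetry; apply: wiso => //; exact: O_iso QL OQ.
Qed.

Lemma classM_zero (A B : C) : O A -> O B -> classM O (0 : Mor A B).
Proof.
move=> OA OB; split.
- by exists A, (idm A); split=> //; exact: isKernel_zero.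
- by exists B, (idm B); split=> //; exact: isCokernel_zero.
Qed.

Lemma morWeight_zero (A B : C) : O A -> O B ->
  morWeight w (0 : Mor A B) = (w A + w B)%E.
Proof.
move=> OA OB; rewrite /morWeight.
by rewrite (weight_kerObj (isKernel_zero A B) OA)
           (weight_cokerObj (isCokernel_zero A B) OB).
Qed.

End Weight.

Theorem proposition3p25 (R : realType) (C : additiveCategory) (O : set C)
    (w : C -> \bar R) (O_zero : O (zeroObj C)) (O_iso : closedUnderIso O)
    (w_weight : isWeight O w) :
  forall A B : C, O A -> O B -> (pathMetric O w A B <= w A + w B)%E.
Proof.
move=> A B OA OB; apply: ereal_inf_lbound.
(* Any admissible zigzag bounds the infimum; the second leg points from [B] to zero and is traversed
   backwards. *)
exists (zzfwd (0 : Mor A (zeroObj C)) (zzbwd (0 : Mor B (zeroObj C)) (zznil B))).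
  by split; [|split=> //]; apply: classM_zero.
case: (w_weight) => _ w0 _ /=.
by rewrite !(morWeight_zero O_iso w_weight)// w0 !adde0.
Qed.
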